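(* The family $\mathcal{L}(\mathrm{IND}_{\mathrm{FIN}})$ of finite-index indexed languages is a full trio, that is, it is closed under morphisms, under inverse morphisms, and under intersection with regular languages.
   Context: An indexed grammar is a 5-tuple $G=(V,T,I,P,S)$ where $V,T,I$ are finite pairwise disjoint sets (variables, terminals, indices), $S\in V$ is the start variable, and $P$ is a finite set of productions of the forms (1) $A\to\nu$, (2) $A\to Bf$, (3) $Af\to\nu$, with $A,B\in V$, $f\in I$, $\nu\in(V\cup T)^*$. Sentential forms are words in $(VI^*\cup T)^*$. In one derivation step $\Rightarrow$, an occurrence $A\alpha$ in a sentential form ($A\in V$, $\alpha\in I^*$ the maximal word of indices following it) is replaced as follows: by (1) $A\to w_1C_1\cdots w_\ell C_\ell w_{\ell+1}$ ($w_j\in T^*$, $C_j\in V$), it is replaced by $w_1C_1\alpha\cdots w_\ell C_\ell\alpha w_{\ell+1}$; by (2) $A\to Bf$, it is replaced by $Bf\alpha$; by (3) $Af\to w_1C_1\cdots w_\ell C_\ell w_{\ell+1}$, if $\alpha=f\alpha'$, it is replaced by $w_1C_1\alpha'\cdots w_\ell C_\ell\alpha' w_{\ell+1}$. The generated language is $L(G)=\{u\in T^*: S\Rightarrow^* u\}$. For $k\ge1$, a derivation $\nu_0\Rightarrow\cdots\Rightarrow\nu_n$ is of index-$k$ if every $\nu_i$ contains at most $k$ occurrences of variables. $G$ is of index-$k$ if every $u\in L(G)$ has some derivation from $S$ of index-$k$. $\mathcal{L}(\mathrm{IND}_{\mathrm{FIN}})$ is the family of languages generated by an indexed grammar of index-$k$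 for some $k\ge1$. Morphisms are monoid morphisms between finitely generated free monoids (possibly erasing). *)

(* Defs.v *)
From HB Require Import structures.
From mathcomp Require Import all_boot.
From mathcomp Require Import classical_sets.

Set Implicit Arguments.
Unset Strict Implicit.
Unset Printing Implicit Defensive.

Local Open Scope classical_set_scope.

Inductive production (V T I : finType) :=
  | Copy of V & seq (V + T)        (* A -> nu *)
  | Push of V & V & I              (* A -> B f *)
  | Pop of V & I & seq (V + T).    (* A f -> nu *)

Arguments Copy {V T I}.
Arguments Push {V T I}.
Arguments Pop {V T I}.

Section ProductionEqType.
Variables V T I : finType.

Definition production_code (p : production V T I) :
    V * seq (V + T) + V * V * I + V * I * seq (V + T) :=
  match p with
  | Copy A nu => inl (inl (A, nu))
  | Push A B f => inl (inr (A, B, f))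
  | Pop A f nu => inr (A, f, nu)
  end.

Definition production_decode
    (c : V * seq (V + T) + V * V * I + V * I * seq (V + T)) : production V T I :=
  match c with
  | inl (inl (A, nu)) => Copy A nu
  | inl (inr (A, B, f)) => Push A B f
  | inr (A, f, nu) => Pop A f nu
  end.

Lemma production_codeK : cancel production_code production_decode.
Proof. by case. Qed.

HB.instance Definition _ :=
  Equality.copy (production V T I) (can_type production_codeK).

End ProductionEqType.

(* Variables, terminals and indices live in three separate types, which makes
   them pairwise disjoint. The list [productions] stands for the finite set of
   its members. *)
Record indexed_grammar (T : finType) := IndexedGrammar {
  variable : finType;
  index : finType;
  productions : seq (production variable T index);
  start : variable }.

Section Derivation.
Variables (T : finType) (G : indexed_grammar T).

(* A word of (V I^* + T)^* factors uniquely into terminals and blocks A alpha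
   with alpha the maximal index word following A; [inl (A, alpha)] is such a
   block. *)
Definition sentential_form := seq (variable G * seq (index G) + T).

Definition distribute (nu : seq (variable G + T)) (alpha : seq (index G)) :
    sentential_form :=
  [seq match x with inl C => inl (C, alpha) | inr a => inr a end | x <- nu].

Inductive step : sentential_form -> sentential_form -> Prop :=
  | step_copy (x y : sentential_form) A nu alpha :
      Copy A nu \in productions G ->
      step (x ++ inl (A, alpha) :: y) (x ++ distribute nu alpha ++ y)
  | step_push (x y : sentential_form) A B f alpha :
      Push A B f \in productions G ->
      step (x ++ inl (A, alpha) :: y) (x ++ inl (B, f :: alpha) :: y)
  | step_pop (x y : sentential_form) A f nu alpha :
      Pop A f nu \in productions G ->
      step (x ++ inl (A, f :: alpha) :: y) (x ++ distribute nu alpha ++ y).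

(* [derivation x s]: with s = [:: x_1; ...; x_n], x => x_1 => ... => x_n. *)
Fixpoint derivation (x : sentential_form) (s : seq sentential_form) : Prop :=
  if s is y :: s' then step x y /\ derivation y s' else True.

Definition nb_variables (x : sentential_form) : nat :=
  count (fun b => if b is inl _ then true else false) x.

Definition start_form : sentential_form := [:: inl (start G, [::])].

Definition terminal_form (u : seq T) : sentential_form := [seq inr a | a <- u].

Definition language : set (seq T) :=
  [set u | exists s, derivation start_form s /\
                     last start_form s = terminal_form u].

Definition of_index (k : nat) : Prop :=
  forall u, language u ->
    exists s, [/\ derivation start_form s,
                  last start_form s = terminal_form u &
                  all (fun x => nb_variables x <= k) (start_form :: s)].

End Derivation.

Definition language_family := forall T : finType, set (set (seq T)).

Definition IND_FIN : language_family := fun T =>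
  [set L | exists (G : indexed_grammar T) (k : nat),
             [/\ 1 <= k, of_index G k & language G = L]].

Record dfa (T : finType) := DFA {
  state : finType;
  initial : state;
  final : {set state};
  transition : state -> T -> state }.

Definition regular (T : finType) : set (set (seq T)) :=
  [set R | exists M : dfa T,
             R = [set w | foldl (@transition T M) (initial M) w \in final M]].

Definition word_morphism (A B : finType) (h : seq A -> seq B) : Prop :=
  h [::] = [::] /\ forall u v, h (u ++ v) = h u ++ h v.

Definition closed_morphism (F : language_family) : Prop :=
  forall (A B : finType) (h : seq A -> seq B) (L : set (seq A)),
    word_morphism h -> F A L -> F B (h @` L).

Definition closed_inverse_morphism (F : language_family) : Prop :=
  forall (A B : finType) (h : seq A -> seq B) (L : set (seq B)),
    word_morphism h -> F B L -> F A (h @^-1` L).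

Definition closed_regular_intersection (F : language_family) : Prop :=
  forall (A : finType) (L R : set (seq A)),
    F A L -> regular R -> F A (L `&` R).

Definition full_trio (F : language_family) : Prop :=
  [/\ closed_morphism F, closed_inverse_morphism F &
      closed_regular_intersection F].

(* Main.v *)
From mathcomp Require Import all_boot.
From mathcomp Require Import classical_sets.
Require Import Defs.

(** All three closure properties are instances of closure under rational
    transductions. Given a grammar [G] and a transducer, the new grammar has
    variables [(p, X, r)], with [X] a variable or a terminal of [G], deriving
    the outputs of the runs from [p] to [r] on the words derived from [X].
    Silent moves of the transducer are emitted one at a time, in front of the
    next letter read or at the end of the input, hence a letter [b] becomes a
    variable [(p, b, r)] with right-linear productions. Expanding these letter
    variables as soon as they appear keeps the index bounded by that of [G]
    plus the maximal length of a right-hand side of [G]. Conversely, leftmost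
    derivations of the new grammar project to leftmost derivations of [G]. *)

Set Implicit Arguments.
Unset Strict Implicit.
Unset Printing Implicit Defensive.

Local Open Scope classical_set_scope.

(** * Derivations with bounded index and leftmost derivations *)

Section Derivations.
Variables (T : finType) (G : indexed_grammar T).
Implicit Types (x y z : sentential_form G) (u v : seq T).

Lemma terminal_form_cat u v :
  terminal_form G (u ++ v) = terminal_form G u ++ terminal_form G v.
Proof. exact: map_cat. Qed.

Lemma distribute_cat nu1 nu2 alpha :
  distribute (G := G) (nu1 ++ nu2) alpha =
  distribute nu1 alpha ++ distribute nu2 alpha.
Proof. exact: map_cat. Qed.

Lemma distribute_terminal u alpha :
  distribute (G := G) [seq inr a | a <- u] alpha = terminal_form G u.
Proof. by rewrite /distribute -map_comp. Qed.

Lemma nb_variables_cat x y :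
  nb_variables (x ++ y) = nb_variables x + nb_variables y.
Proof. exact: count_cat. Qed.

Lemma nb_variables_terminal u : nb_variables (terminal_form G u) = 0.
Proof. by elim: u. Qed.

Lemma step_context z1 z2 x y : step x y -> step (z1 ++ x ++ z2) (z1 ++ y ++ z2).
Proof.
case=> {x y} [x y A nu al|x y A B f al|x y A f nu al] Hp;
  rewrite -!catA /= -?catA !(catA z1).
- exact: step_copy.
- exact: step_push.
- exact: step_pop.
Qed.

Definition bounded_derives k x y :=
  exists s, [/\ derivation x s, last x s = y &
                all (fun z => nb_variables z <= k) (x :: s)].

Lemma bounded_derives_refl k x : nb_variables x <= k -> bounded_derives k x x.
Proof. by move=> Hx; exists [::]; split; rewrite //= Hx. Qed.

Lemma bounded_derives_step k x y z :
  nb_variables x <= k -> step x y -> bounded_derives k y z ->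
  bounded_derives k x z.
Proof.
by move=> Hx Hxy [s [Hs Hl Ha]]; exists (y :: s); split=> //=; rewrite Hx.
Qed.

Lemma bounded_derives_trans k x y z :
  bounded_derives k x y -> bounded_derives k y z -> bounded_derives k x z.
Proof.
case=> s; elim: s x => [|x' s IH] x [/=].
  by move=> _ <-.
case=> Hx Hs Hl /andP[Hk Ha] Hz; apply: bounded_derives_step Hx _ => //.
by apply: IH Hz; split.
Qed.

Lemma bounded_derives_context k k' z1 z2 x y :
  nb_variables z1 + k + nb_variables z2 <= k' ->
  bounded_derives k x y ->
  bounded_derives k' (z1 ++ x ++ z2) (z1 ++ y ++ z2).
Proof.
move=> Hk [s]; elim: s x => [|x' s IH] x [/=].
  move=> _ <- /andP[Hx _]; apply: bounded_derives_refl.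
  apply: leq_trans Hk; rewrite !nb_variables_cat addnA leq_add2r leq_add2l //.
case=> Hx Hs Hl /andP[Hxk Ha]; apply: bounded_derives_step.
- apply: leq_trans Hk.
  by rewrite !nb_variables_cat addnA leq_add2r leq_add2l.
- exact: step_context Hx.
- exact: IH.
Qed.

(* Leftmost derivations of terminal words. *)
Inductive yields : sentential_form G -> seq T -> Prop :=
  | yields_nil : yields [::] [::]
  | yields_terminal a x u : yields x u -> yields (inr a :: x) (a :: u)
  | yields_copy A nu alpha x u :
      Copy A nu \in productions G ->
      yields (distribute nu alpha ++ x) u -> yields (inl (A, alpha) :: x) u
  | yields_push A B f alpha x u :
      Push A B f \in productions G ->
      yields (inl (B, f :: alpha) :: x) u -> yields (inl (A, alpha) :: x) u
  | yields_pop A f nu alpha x u :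
      Pop A f nu \in productions G ->
      yields (distribute nu alpha ++ x) u -> yields (inl (A, f :: alpha) :: x) u.

Lemma yields_terminal_form u : yields (terminal_form G u) u.
Proof. by elim: u => [|a u IH]; constructor. Qed.

(** A leftmost derivation consumes [x] entirely before touching [y], and rewriting inside [x] leaves
    [y] intact. Hence the induction generalizes over [x], and the hypothesis applies exactly when
    [x] is exhausted. *)
Lemma yields_prefix x y y' :
  (forall u, yields y u -> yields y' u) ->
  forall u, yields (x ++ y) u -> yields (x ++ y') u.
Proof.
move=> Hy u Hu; move Ez: (x ++ y) Hu => z Hu.
elim: Hu x Ez => {z u} [|a z u Hz IH|A nu al z u Hp Hz IH
    |A B f al z u Hp Hz IH|A f nu al z u Hp Hz IH] [|c x] //= Ez.
- by apply: Hy; rewrite Ez; constructor.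
- by apply: Hy; rewrite Ez; constructor.
- by case: Ez => -> Ez; constructor; apply: IH.
- by apply: Hy; rewrite Ez; apply: yields_copy Hz.
- case: Ez => -> Ez; apply: (yields_copy Hp).
  by rewrite catA; apply: IH; rewrite -catA Ez.
- by apply: Hy; rewrite Ez; apply: yields_push Hz.
- case: Ez => -> Ez; apply: (yields_push Hp).
  by rewrite -cat_cons; apply: IH; rewrite /= Ez.
- by apply: Hy; rewrite Ez; apply: yields_pop Hz.
- case: Ez => -> Ez; apply: (yields_pop Hp).
  by rewrite catA; apply: IH; rewrite -catA Ez.
Qed.

(** A step at an arbitrary position can be postponed until its variable becomes leftmost. *)
Lemma yields_step x y u : step x y -> yields y u -> yields x u.
Proof.
case=> {x y} [x y A nu al|x y A B f al|x y A f nu al] Hp;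
  apply: yields_prefix => v.
- exact: yields_copy.
- exact: yields_push.
- exact: yields_pop.
Qed.

(** The word [v] collects the terminals already passed over, so that the induction can work to their
    right. *)
Lemma yields_derivation x u :
  yields x u -> forall v, exists s,
    derivation (terminal_form G v ++ x) s /\
    last (terminal_form G v ++ x) s = terminal_form G (v ++ u).
Proof.
elim=> {x u} [|a x u _ IH|A nu al x u Hp _ IH|A B f al x u Hp _ IH
    |A f nu al x u Hp _ IH] v.
- by exists [::]; rewrite !cats0.
- have := IH (rcons v a).
  by rewrite /terminal_form map_rcons !cat_rcons.
- have [s [Hs Hl]] := IH v.
  exists ((terminal_form G v ++ distribute nu al ++ x) :: s); split=> //=.
  by split=> //; apply: step_copy.
- have [s [Hs Hl]] := IH v.
  exists ((terminal_form G v ++ inl (B, f :: al) :: x) :: s); split=> //=.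
  by split=> //; apply: step_push.
- have [s [Hs Hl]] := IH v.
  exists ((terminal_form G v ++ distribute nu al ++ x) :: s); split=> //=.
  by split=> //; apply: step_pop.
Qed.

Lemma language_yields u : language G u <-> yields (start_form G) u.
Proof.
split=> [[s []]|/yields_derivation /(_ [::])]; last by [].
elim: s (start_form G) => [|y s IH] x /=.
  by move=> _ ->; exact: yields_terminal_form.
by case=> Hxy Hs Hl; apply: yields_step Hxy _; exact: IH.
Qed.

End Derivations.

(** * Rational transducers and their runs *)

Record transducer (A B : finType) := Transducer {
  tstate : finType;
  tinitial : tstate;
  tfinal : pred tstate;
  tsilent : tstate -> seq (seq A * tstate);
  tread : tstate -> B -> seq (seq A * tstate) }.

Inductive run (A B : finType) (M : transducer A B) :
    tstate M -> seq B -> seq A -> Prop :=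
  | run_final p : tfinal p -> run p [::] [::]
  | run_silent p p' u v w :
      (v, p') \in tsilent p -> run p' u w -> run p u (v ++ w)
  | run_read p p' b u v w :
      (v, p') \in tread p b -> run p' u w -> run p (b :: u) (v ++ w).

(** Silent moves are grouped with the letter that follows them, and the reading move comes last. A
    run then factors into one block per letter and a final run on the empty input. *)
Inductive letter_run (A B : finType) (M : transducer A B) :
    tstate M -> B -> seq A -> tstate M -> Prop :=
  | letter_run_silent p p' r b v w :
      (v, p') \in tsilent p -> letter_run p' b w r -> letter_run p b (v ++ w) r
  | letter_run_read p r b v : (v, r) \in tread p b -> letter_run p b v r.

Lemma run_cons (A B : finType) (M : transducer A B) (p : tstate M) b u w :
  run p (b :: u) w ->
  exists r w1 w2, [/\ letter_run p b w1 r, run r u w2 & w = w1 ++ w2].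
Proof.
move Ebu: (b :: u) => bu Hr; elim: Hr b u Ebu => {p bu w} //.
- move=> p p' u' v w Hv _ IH b u /IH[r [w1 [w2 [H1 H2 ->]]]].
  exists r, (v ++ w1), w2; split=> //; last exact: catA.
  exact: letter_run_silent Hv H1.
- move=> p p' b' u' v w Hv Hr _ b u [-> ->].
  by exists p', v, w; split=> //; apply: letter_run_read.
Qed.

(** * The grammar of a transduced language *)

Section Transduction.
Variables (A B : finType) (M : transducer A B) (G : indexed_grammar B).

Local Notation Q := (tstate M).
Local Notation V := (variable G).

(* [None] is the start variable, [Some (inl p)] emits the silent moves made
   after the whole input has been read, [Some (inr (p, X, r))] is [(p, X, r)]. *)
Definition tvariable : finType := option (Q + Q * (V + B) * Q).

Local Notation tproduction := (production tvariable A (index G)).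

(** The intermediate states are guessed here. Terminals of [nu] become variables as well, since
    reading one letter may involve several silent moves, each being a production of its own. *)
Fixpoint annotations (p : Q) (nu : seq (V + B)) (r : Q) :
    seq (seq (tvariable + A)) :=
  if nu is X :: nu' then
    [seq inl (Some (inr (p, X, q))) :: t | q <- enum Q, t <- annotations q nu' r]
  else if p == r then [:: [::]] else [::].

Definition silent_productions (X : tvariable) (p : Q) (next : Q -> tvariable) :
    seq tproduction :=
  [seq Copy X ([seq inr a | a <- vq.1] ++ [:: inl (next vq.2)]) |
     vq <- tsilent p].

Definition annotated_production (p : Q) (C : V) (r : Q)
    (pr : production V B (index G)) : seq tproduction :=
  let X D := Some (inr (p, inl D, r)) in
  match pr with
  | Copy D nu =>
      if D == C then [seq Copy (X C) t | t <- annotations p nu r] else [::]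
  | Push D E f => if D == C then [:: Push (X C) (X E) f] else [::]
  | Pop D f nu =>
      if D == C then [seq Pop (X C) f t | t <- annotations p nu r] else [::]
  end.

Definition tproductions_of (X : tvariable) : seq tproduction :=
  match X with
  | None => [seq Copy None [:: inl (Some (inr (tinitial M, inl (start G), r)));
                              inl (Some (inl r))] | r <- enum Q]
  | Some (inl p) =>
      silent_productions X p (fun q => Some (inl q)) ++
      (if tfinal p then [:: Copy X [::]] else [::])
  | Some (inr (p, inr b, r)) =>
      silent_productions X p (fun q => Some (inr (q, inr b, r))) ++
      [seq Copy X [seq inr a | a <- vq.1] | vq <- tread p b & vq.2 == r]
  | Some (inr (p, inl C, r)) =>
      flatten [seq annotated_production p C r pr | pr <- productions G]
  end.

Definition transduced_grammar : indexed_grammar A :=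
  @IndexedGrammar A tvariable (index G)
    (flatten [seq tproductions_of X | X <- enum tvariable]) None.

Local Notation G' := transduced_grammar.

Definition production_lhs (pr : tproduction) : tvariable :=
  match pr with Copy X _ => X | Push X _ _ => X | Pop X _ _ => X end.

Lemma tproductions_of_lhs X pr : pr \in tproductions_of X -> production_lhs pr = X.
Proof.
case: X => [[p|[[p [C|b]] r]]|] /=.
- rewrite mem_cat => /orP[/mapP[vq _ ->] //|].
  by case: ifP => // _; rewrite inE => /eqP ->.
- case/flatten_mapP=> -[D nu|D E f|D f nu] _ /=; case: eqP => // _.
  + by case/mapP=> t _ ->.
  + by rewrite inE => /eqP ->.
  + by case/mapP=> t _ ->.
- by rewrite mem_cat => /orP[] /mapP[vq _ ->].
- by case/mapP=> r _ ->.
Qed.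

(** The list is built in blocks, one per left-hand side, so the left-hand side of a production
    determines the only block to search. *)
Lemma mem_productions (pr : production (variable G') A (index G')) :
  (pr \in productions G') = (pr \in tproductions_of (production_lhs pr)).
Proof.
apply/flatten_mapP/idP => [[X _ HX]|H].
  by rewrite (tproductions_of_lhs HX).
by exists (production_lhs pr); rewrite ?mem_enum.
Qed.

Lemma mem_annotated_copy p C r nu t :
  Copy C nu \in productions G -> t \in annotations p nu r ->
  Copy (Some (inr (p, inl C, r))) t \in productions G'.
Proof.
move=> HC Ht; rewrite mem_productions; apply/flatten_mapP.
by exists (Copy C nu) => //=; rewrite eqxx; apply: map_f.
Qed.

Lemma mem_annotated_push p C D f r :
  Push C D f \in productions G ->
  Push (Some (inr (p, inl C, r))) (Some (inr (p, inl D, r))) f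
    \in productions G'.
Proof.
move=> HC; rewrite mem_productions; apply/flatten_mapP.
by exists (Push C D f) => //=; rewrite eqxx inE.
Qed.

Lemma mem_annotated_pop p C f r nu t :
  Pop C f nu \in productions G -> t \in annotations p nu r ->
  Pop (Some (inr (p, inl C, r))) f t \in productions G'.
Proof.
move=> HC Ht; rewrite mem_productions; apply/flatten_mapP.
by exists (Pop C f nu) => //=; rewrite eqxx; apply: map_f.
Qed.

(** * Soundness: projecting leftmost derivations to [G] *)

(* [annotated p x x']: the form [x'], with no terminal, is [x] annotated with a
   run from [p] and followed by a variable for the end of the input. Variables
   standing for letters ignore their index word. *)
Inductive annotated : Q -> sentential_form G -> sentential_form G' -> Prop :=
  | annotated_nil p beta : annotated p [::] [:: inl (Some (inl p), beta)]
  | annotated_variable p r C alpha x x' :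
      annotated r x x' ->
      annotated p (inl (C, alpha) :: x)
                  (inl (Some (inr (p, inl C, r)), alpha) :: x')
  | annotated_letter p r b beta x x' :
      annotated r x x' ->
      annotated p (inr b :: x) (inl (Some (inr (p, inr b, r)), beta) :: x').

Lemma annotated_distribute p nu r t alpha x x' :
  t \in annotations p nu r -> annotated r x x' ->
  annotated p (distribute nu alpha ++ x)
              (distribute (G := G') t alpha ++ x').
Proof.
move=> + Hx; elim: nu p t => [|X nu IH] p t /=.
  by case: eqP => [->|//]; rewrite inE => /eqP ->.
case/allpairsPdep=> q [t' [_ Ht' ->]] /=.
by case: X => [C|b] /=; constructor; apply: IH.
Qed.

(** Induction on the leftmost derivation. A transducer move puts its output in front of the
    annotated form; [w0] is the part of that output not yet consumed. *)
Lemma annotated_yields x' w : yields (G := G') x' w ->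
  forall w0 p x rest,
    x' = terminal_form G' w0 ++ rest -> annotated p x rest ->
    exists u w1, [/\ w = w0 ++ w1, yields x u & run p u w1].
Proof.
elim=> {x' w} [|a x' w _ IH|X nu al x' w Hp Hy IH|X Y f al x' w Hp _ IH
    |X f nu al x' w Hp _ IH] [|a0 w0] p x rest //=.
(* With [w0] empty, this case and the next are impossible: an annotated form is nonempty and starts
   with a variable. *)
- by move=> <- H; inversion H.
- by move=> <- H; inversion H.
- by case=> -> Ex' /(IH _ _ _ _ Ex')[u [w1 [-> H1 H2]]]; exists u, w1.
- move=> <- H; move: Hp; rewrite mem_productions.
  inversion H; subst=> /=.
  + rewrite mem_cat => /orP[/mapP[[v q] /= Hv [Enu]]|].
      have [||u [w1 [-> H1 H2]]] := IH v q [::] [:: inl (Some (inl q), al)].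
      * by rewrite Enu distribute_cat distribute_terminal -catA.
      * exact: annotated_nil.
      * by exists u, (v ++ w1); split=> //; apply: run_silent Hv H2.
    case: ifP => // Hf; rewrite inE => /eqP[Enu].
    (* The variable for the end of the input is the last symbol, so erasing it leaves the empty
       form, which yields only the empty word. *)
    rewrite Enu in Hy; inversion Hy; subst.
    by exists [::], [::]; split=> //; constructor.
  + case/flatten_mapP=> -[D mu|D E f|D f mu] Hpr /=; case: eqP => // ED.
    * case/mapP=> t Ht [Et]; subst.
      have [||u [w1 [-> H1 H2]]] :=
        IH [::] p (distribute mu al ++ x0) (distribute (G := G') t al ++ x') => //.
        by apply: annotated_distribute Ht _.
      by exists u, w1; split=> //; apply: yields_copy H1.
    * by case/mapP.
  + rewrite mem_cat => /orP[/mapP[[v q] /= Hv [Enu]]|].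
      have [||u [w1 [-> H1 H2]]] := IH v q (inr b :: x0)
        (inl (Some (inr (q, inr b, r)), al) :: x').
      * by rewrite Enu distribute_cat distribute_terminal -catA.
      * exact: annotated_letter.
      * by exists u, (v ++ w1); split=> //; apply: run_silent Hv H2.
    case/mapP=> -[v q]; rewrite mem_filter /= => /andP[/eqP -> Hv] [Enu].
    have [||u [w1 [-> H1 H2]]] := IH v r x0 x' => //.
      by rewrite Enu distribute_terminal.
    exists (b :: u), (v ++ w1); split=> //; first by constructor.
    exact: run_read Hv H2.
- move=> <- H; move: Hp; rewrite mem_productions.
  inversion H; subst=> /=.
  + rewrite mem_cat => /orP[/mapP[]//|].
    by case: ifP => // _; rewrite inE => /eqP.
  + case/flatten_mapP=> -[D mu|D E g|D g mu] Hpr /=; case: eqP => // ED.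
    * by case/mapP.
    * rewrite inE => /eqP[EY Eg]; subst.
      have [||u [w1 [-> H1 H2]]] := IH [::] p (inl (E, g :: al) :: x0)
        (inl (Some (inr (p, inl E, r)), g :: al) :: x') => //.
        exact: annotated_variable.
      by exists u, w1; split=> //; apply: yields_push H1.
    * by case/mapP.
  + by rewrite mem_cat => /orP[] /mapP[].
- move=> <- H; move: Hp; rewrite mem_productions.
  inversion H; subst=> /=.
  + rewrite mem_cat => /orP[/mapP[]//|].
    by case: ifP => // _; rewrite inE => /eqP.
  + case/flatten_mapP=> -[D mu|D E g|D g mu] Hpr /=; case: eqP => // ED.
    * by case/mapP.
    * case/mapP=> t Ht [Eg Et]; subst.
      have [||u [w1 [-> H1 H2]]] :=
        IH [::] p (distribute mu al ++ x0) (distribute (G := G') t al ++ x') => //.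
        by apply: annotated_distribute Ht _.
      by exists u, w1; split=> //; apply: yields_pop H1.
  + by rewrite mem_cat => /orP[] /mapP[].
Qed.

Lemma language_transduced_sub w :
  language G' w -> exists2 u, language G u & run (tinitial M) u w.
Proof.
move/language_yields=> H; inversion H as [| |X nu al x u Hp Hy|X Y f al x u Hp
    |]; subst.
- move: Hp; rewrite mem_productions /= => /mapP[r _ [Enu]].
  rewrite Enu in Hy.
  have [|v [w1 [-> H1 H2]]] :=
    annotated_yields Hy (w0 := [::]) (p := tinitial M) (x := start_form G) erefl.
    by do 2!constructor.
  by exists v => //; apply/language_yields.
- by move: Hp; rewrite mem_productions /= => /mapP[].
Qed.

(** * Completeness: lifting derivations of [G] with a bounded index *)

(* [transduced p x x']: [x'] is [x] annotated with a run from [p] whose outputs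
   on the terminals of [x] and at the end of the input are already produced. *)
Inductive transduced : Q -> sentential_form G -> sentential_form G' -> Prop :=
  | transduced_nil p w : run p [::] w -> transduced p [::] (terminal_form G' w)
  | transduced_variable p r C alpha x x' :
      transduced r x x' ->
      transduced p (inl (C, alpha) :: x)
                   (inl (Some (inr (p, inl C, r)), alpha) :: x')
  | transduced_letter p r b w x x' :
      letter_run p b w r -> transduced r x x' ->
      transduced p (inr b :: x) (terminal_form G' w ++ x').

Lemma transduced_terminal p u w :
  run p u w -> transduced p (terminal_form G u) (terminal_form G' w).
Proof.
elim: u p w => [|b u IH] p w; first exact: transduced_nil.
case/run_cons=> r [w1 [w2 [H1 H2 ->]]].
by rewrite terminal_form_cat; apply: transduced_letter H1 _; apply: IH.
Qed.

(** Letters and the end of the input have already been turned into output, so only the variables of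
    [x] remain. This transfers the index bound of [G]. *)
Lemma nb_variables_transduced p x x' :
  transduced p x x' -> nb_variables x' = nb_variables x.
Proof.
elim=> {p x x'} [p w _|p r C al x x' _ /= ->//|p r b w x x' _ _ /= IH].
  exact: nb_variables_terminal.
by rewrite nb_variables_cat nb_variables_terminal IH.
Qed.

(** The last clause permits replacing the suffix by any other one annotated from the same state [r],
    which is how a step is undone in context. *)
Lemma transduced_split p x z y' : transduced p (x ++ z) y' ->
  exists r x' z', [/\ y' = x' ++ z', transduced r z z',
    nb_variables x' = nb_variables x &
    forall z2 z2', transduced r z2 z2' -> transduced p (x ++ z2) (x' ++ z2')].
Proof.
elim: x p y' => [|c x IH] p y' /=; first by exists p, [::], y'; split.
move=> H; inversion H as [|p0 r C al x0 x0' H0|p0 r b w x0 x0' Hw H0]; subst.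
- have [q [x' [z' [-> H1 H2 H3]]]] := IH _ _ H0.
  exists q, (inl (Some (inr (p, inl C, r)), al) :: x'), z'; split=> //=.
    by rewrite H2.
  by move=> z2 z2' Hz; constructor; apply: H3.
- have [q [x' [z' [-> H1 H2 H3]]]] := IH _ _ H0.
  exists q, (terminal_form G' w ++ x'), z'; split=> //=; first exact: catA.
    by rewrite nb_variables_cat nb_variables_terminal H2.
  by move=> z2 z2' Hz; rewrite -catA; apply: transduced_letter Hw _; apply: H3.
Qed.

(** The bound is 1 because the productions of letter variables are right-linear or terminal. *)
Lemma letter_run_derives p b w r alpha : letter_run p b w r ->
  bounded_derives (G := G') 1 [:: inl (Some (inr (p, inr b, r)), alpha)]
                              (terminal_form G' w).
Proof.
elim=> {p b w r} [p p' r b v w Hv _ IH|p r b v Hv].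
- apply: (bounded_derives_step (y := terminal_form G' v ++
      [:: inl (Some (inr (p', inr b, r)), alpha)])) => //.
    have -> : terminal_form G' v ++ [:: inl (Some (inr (p', inr b, r)), alpha)]
      = [::] ++ distribute (G := G') ([seq inr a | a <- v] ++
          [:: inl (Some (inr (p', inr b, r)))]) alpha ++ [::].
      by rewrite cats0 distribute_cat distribute_terminal.
    apply: (step_copy [::] [::]); rewrite mem_productions /=.
    by rewrite mem_cat; apply/orP; left; apply/mapP; exists (v, p').
  rewrite terminal_form_cat -(cats0 (terminal_form G' w)).
  rewrite -[X in _ ++ X]cats0.
  by apply: bounded_derives_context IH; rewrite nb_variables_terminal.
- apply: (bounded_derives_step (y := terminal_form G' v)) => //.
    rewrite -(distribute_terminal (G := G') v alpha) -[X in step _ X]cats0.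
    apply: (step_copy [::] [::]); rewrite mem_productions /=.
    rewrite mem_cat; apply/orP; right; apply/mapP; exists (v, r) => //.
    by rewrite mem_filter eqxx.
  by apply: bounded_derives_refl; rewrite nb_variables_terminal.
Qed.

Lemma end_run_derives p w alpha : run p [::] w ->
  bounded_derives (G := G') 1 [:: inl (Some (inl p), alpha)]
                              (terminal_form G' w).
Proof.
move Eu: [::] => u H; elim: H Eu => {p u w} [p Hf _|p p' u v w Hv _ IH Eu|] //.
- apply: (bounded_derives_step (y := [::])) => //.
    apply: (step_copy (G := G') (nu := [::]) [::] [::]).
    by rewrite mem_productions /= mem_cat Hf inE eqxx orbT.
  exact: bounded_derives_refl.
- apply: (bounded_derives_step (y := terminal_form G' v ++
      [:: inl (Some (inl p'), alpha)])) => //.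
    have -> : terminal_form G' v ++ [:: inl (Some (inl p'), alpha)]
      = [::] ++ distribute (G := G') ([seq inr a | a <- v] ++
          [:: inl (Some (inl p'))]) alpha ++ [::].
      by rewrite cats0 distribute_cat distribute_terminal.
    apply: (step_copy [::] [::]); rewrite mem_productions /=.
    by rewrite mem_cat; apply/orP; left; apply/mapP; exists (v, p').
  rewrite terminal_form_cat -(cats0 (terminal_form G' w)).
  rewrite -[X in _ ++ X]cats0.
  by apply: bounded_derives_context (IH Eu); rewrite nb_variables_terminal.
Qed.

(** The annotation [t] is read off the run recorded in [y']. Its letter variables are expanded from
    left to right, so the number of variables never exceeds the initial [size nu]. *)
Lemma transduced_distribute p nu alpha z y' :
  transduced p (distribute nu alpha ++ z) y' ->
  exists r t x' z', [/\ t \in annotations p nu r, y' = x' ++ z',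
    transduced r z z' &
    bounded_derives (size nu) (distribute (G := G') t alpha) x'].
Proof.
elim: nu p y' => [|X nu IH] p y' /=.
  move=> H; exists p, [::], [::], y'; split; rewrite ?eqxx ?inE //.
  exact: bounded_derives_refl.
case: X => [C|b] /= H;
  inversion H as [|p0 q C0 al x0 x0' H0|p0 q b0 w x0 x0' Hw H0]; subst.
- have [r [t [x' [z' [Ht -> Hz Hd]]]]] := IH _ _ H0.
  exists r, (inl (Some (inr (p, inl C, q))) :: t),
    (inl (Some (inr (p, inl C, q)), alpha) :: x'), z'; split=> //.
    by apply/allpairsPdep; exists q, t; rewrite mem_enum.
  have := bounded_derives_context (G := G') (k' := (size nu).+1) (z2 := [::])
    (z1 := [:: inl (Some (inr (p, inl C, q)), alpha)]) _ Hd.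
  by rewrite !cats0; apply; rewrite /= addn0.
- have [r [t [x' [z' [Ht -> Hz Hd]]]]] := IH _ _ H0.
  exists r, (inl (Some (inr (p, inr b, q))) :: t),
    (terminal_form G' w ++ x'), z'; split=> //.
  + by apply/allpairsPdep; exists q, t; rewrite mem_enum.
  + exact: catA.
  + apply: (bounded_derives_trans
      (y := terminal_form G' w ++ distribute (G := G') t alpha)).
      apply: (bounded_derives_context (z1 := [::]) _ (letter_run_derives alpha Hw)).
      rewrite /= add0n add1n ltnS.
      (* The first form of the derivation [Hd] bounds the number of variables of the tail, which
         waits while the head letter is expanded. *)
      by case: Hd => s' [_ _ /andP[]].
    rewrite -[distribute (G := G') t _]cats0 -[x']cats0.
    apply: bounded_derives_context Hd.
    by rewrite nb_variables_terminal addn0.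
Qed.

Definition rhs_size (pr : production V B (index G)) : nat :=
  match pr with Copy _ nu => size nu | Push _ _ _ => 1 | Pop _ _ nu => size nu end.

Definition max_rhs_size : nat := \max_(pr <- productions G) rhs_size pr.

(** The argument goes backwards because the states to be guessed at a step are known only from the
    run on what follows it. In the copy and pop cases the context has at most [k] variables, and the
    letters of the right-hand side temporarily add at most [max_rhs_size]. *)
Lemma transduced_step_back k p x y y' :
  nb_variables x <= k -> step x y -> transduced p y y' ->
  exists2 x', transduced p x x' & bounded_derives (k + max_rhs_size) x' y'.
Proof.
move=> + Hs; case: Hs => {x y} [x z C nu al|x z C D f al|x z C f nu al] Hpr Hk Hy.
- have [q [x1 [y1 [-> H1 Hn1 Hc]]]] := transduced_split Hy.
  have [r [t [x2 [z' [Ht -> Hz Hd]]]]] := transduced_distribute H1.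
  have Hx' := Hc _ _ (transduced_variable q C al Hz).
  have Hn := nb_variables_transduced Hx'.
  exists (x1 ++ inl (Some (inr (q, inl C, r)), al) :: z') => //.
  apply: bounded_derives_step.
  + by rewrite Hn; apply: leq_trans Hk (leq_addr _ _).
  + exact: (step_copy _ _ _ (mem_annotated_copy Hpr Ht)).
  + apply: bounded_derives_context Hd; rewrite addnAC leq_add //.
      apply: leq_trans Hk; rewrite -Hn nb_variables_cat leq_add2l.
      exact: leqnSn.
    exact: (leq_bigmax_seq (F := rhs_size) _ Hpr isT).
- have [q [x1 [y1 [-> H1 Hn1 Hc]]]] := transduced_split Hy.
  inversion H1 as [|p0 r C0 al0 z0 z' Hz|]; subst.
  have Hx' := Hc _ _ (transduced_variable q C al Hz).
  exists (x1 ++ inl (Some (inr (q, inl C, r)), al) :: z') => //.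
  apply: bounded_derives_step.
  + rewrite (nb_variables_transduced Hx').
    by apply: leq_trans Hk (leq_addr _ _).
  + exact: (step_push _ _ _ (mem_annotated_push q r Hpr)).
  + apply: bounded_derives_refl.
    have Hy' := Hc _ _ (transduced_variable q D (f :: al) Hz).
    rewrite (nb_variables_transduced Hy').
    apply: leq_trans (leq_addr _ _).
    by move: Hk; rewrite !nb_variables_cat.
- have [q [x1 [y1 [-> H1 Hn1 Hc]]]] := transduced_split Hy.
  have [r [t [x2 [z' [Ht -> Hz Hd]]]]] := transduced_distribute H1.
  have Hx' := Hc _ _ (transduced_variable q C (f :: al) Hz).
  have Hn := nb_variables_transduced Hx'.
  exists (x1 ++ inl (Some (inr (q, inl C, r)), f :: al) :: z') => //.
  apply: bounded_derives_step.
  + by rewrite Hn; apply: leq_trans Hk (leq_addr _ _).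
  + exact: (step_pop _ _ _ (mem_annotated_pop Hpr Ht)).
  + apply: bounded_derives_context Hd; rewrite addnAC leq_add //.
      apply: leq_trans Hk; rewrite -Hn nb_variables_cat leq_add2l.
      exact: leqnSn.
    exact: (leq_bigmax_seq (F := rhs_size) _ Hpr isT).
Qed.

Lemma transduced_derivation k p x u w :
  bounded_derives k x (terminal_form G u) -> run p u w ->
  exists2 x', transduced p x x' &
    bounded_derives (k + max_rhs_size) x' (terminal_form G' w).
Proof.
move=> [s]; elim: s x => [|y s IH] x [/=].
  move=> _ -> _ Hr; exists (terminal_form G' w).
    exact: transduced_terminal.
  by apply: bounded_derives_refl; rewrite nb_variables_terminal.
case=> Hxy Hs Hl /andP[Hk Ha] Hr.
have [y' Hy' Hd] := IH y (And3 Hs Hl Ha) Hr.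
have [x' Hx' Hd'] := transduced_step_back Hk Hxy Hy'.
by exists x' => //; apply: bounded_derives_trans Hd' Hd.
Qed.

Lemma transduced_grammar_derives k u w :
  bounded_derives k (start_form G) (terminal_form G u) ->
  run (tinitial M) u w ->
  bounded_derives (k + max_rhs_size + 2) (start_form G') (terminal_form G' w).
Proof.
move=> Hu Hr; have [x' Hx' [s [Hs Hl Ha]]] := transduced_derivation Hu Hr.
have {Hs Hl Ha} Hd :
    bounded_derives (k + max_rhs_size + 2) x' (terminal_form G' w).
  exists s; split=> //; apply: sub_all Ha => z Hz.
  exact: leq_trans Hz (leq_addr _ _).
(* Here [x'] is one annotated start variable followed by the output [v] at the end of the input. *)
inversion Hx' as [|p0 r C al x0 x0' H0|]; subst.
inversion H0 as [p0 v Hv| |]; subst.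
have Hp : Copy None [:: inl (Some (inr (tinitial M, inl (start G), r)));
    inl (Some (inl r))] \in productions G'.
  by rewrite mem_productions /=; apply/mapP; exists r; rewrite ?mem_enum.
apply: (bounded_derives_step _ (step_copy [::] [::] [::] Hp)).
  by rewrite addn2.
apply: bounded_derives_trans Hd.
(* The final silent moves are performed first, while the annotated start variable waits: two
   variables in all, whence the constant 2. *)
have := end_run_derives [::] Hv.
move/(bounded_derives_context (G := G') (k' := k + max_rhs_size + 2)
  (z1 := [:: inl (Some (inr (tinitial M, inl (start G), r)), [::])])
  (z2 := [::])) => /=.
by rewrite cats0; apply; rewrite addn2.
Qed.

End Transduction.

(** Completeness produces derivations of bounded index; combined with soundness it gives both the
    finite index and the equality of languages. *)
Lemma IND_FIN_transduction (A B : finType) (M : transducer A B)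
    (L : set (seq B)) :
  IND_FIN L -> IND_FIN [set w | exists2 u, L u & run (tinitial M) u w].
Proof.
move=> [G [k [Hk HG <-]]].
have Hcomplete w : (exists2 u, language G u & run (tinitial M) u w) ->
    bounded_derives (k + max_rhs_size G + 2)
      (start_form (transduced_grammar M G))
      (terminal_form (transduced_grammar M G) w).
  by case=> u /HG Hu Hr; apply: transduced_grammar_derives Hr.
exists (transduced_grammar M G), (k + max_rhs_size G + 2); split.
- by rewrite addn2.
- by move=> w /language_transduced_sub/Hcomplete.
- apply/seteqP; split=> w; first exact: language_transduced_sub.
  by case/Hcomplete=> s [Hs Hl _]; exists s.
Qed.

(** * Transducers for morphisms, regular languages and inverse morphisms *)

Lemma word_morphism_cons (A B : finType) (h : seq A -> seq B) a w :
  word_morphism h -> h (a :: w) = h [:: a] ++ h w.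
Proof. by case=> _ hM; rewrite -hM. Qed.

Definition morphism_transducer (A B : finType) (h : seq A -> seq B) :
    transducer B A :=
  @Transducer B A unit tt predT (fun=> [::]) (fun _ a => [:: (h [:: a], tt)]).

Lemma morphism_transducerP (A B : finType) (h : seq A -> seq B) p u w :
  word_morphism h -> run (M := morphism_transducer h) p u w <-> w = h u.
Proof.
move=> Hh; split=> [|->].
- elim=> {p u w} [p _|//|p p' a u v w].
    by case: Hh.
  by rewrite /= inE => /eqP[-> _] _ ->; rewrite (word_morphism_cons a u Hh).
- elim: u p => [|a u IH] p.
    by case: Hh => -> _; apply: run_final.
  rewrite (word_morphism_cons a u Hh); apply: (@run_read _ _ (morphism_transducer h) p tt) (IH tt).
  by rewrite inE.
Qed.

Definition dfa_transducer (A : finType) (D : dfa A) : transducer A A :=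
  @Transducer A A (state D) (initial D) (mem (final D)) (fun=> [::])
    (fun p a => [:: ([:: a], transition p a)]).

Lemma dfa_transducerP (A : finType) (D : dfa A) (p : state D) u w :
  run (M := dfa_transducer D) p u w <->
  w = u /\ foldl (@transition A D) p u \in final D.
Proof.
split=> [|[->]].
- elim=> {p u w} [//|//|p p' a u v w].
  by rewrite /= inE => /eqP[-> ->] _ [-> ?].
- elim: u p => [|a u IH] p /= Hp; first exact: run_final.
  apply: (@run_read _ _ (dfa_transducer D) p (transition p a) a u [:: a]).
    by rewrite inE.
  exact: IH.
Qed.

Section InverseMorphism.
Variables (A B : finType) (h : seq A -> seq B).

(** Bounding the words stored in the states makes the state type finite. *)
Definition max_image_size : nat := \max_(a : A) size (h [:: a]).

Lemma size_image a : size (h [:: a]) <= max_image_size.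
Proof. exact: (leq_bigmax (F := fun a => size (h [:: a]))). Qed.

Lemma size_behead_bseq n (s : n.-bseq B) : size (behead s) <= n.
Proof. by rewrite size_behead (leq_trans (leq_pred _)) ?size_bseq. Qed.

(* The state is the part of the image of the last guessed letter that remains
   to be read; a new letter is guessed when nothing remains. *)
Definition inverse_transducer : transducer A B :=
  @Transducer A B (max_image_size.-bseq B) [bseq] (fun s => nilp s)
    (fun s => if nilp s then [seq ([:: a], Bseq (size_image a)) | a <- enum A]
              else [::])
    (fun s b => if ohead s == Some b then [:: ([::], Bseq (size_behead_bseq s))]
                else [::]).

(** Invariant of the runs: the unread input is the stored word followed by the image of the letters
    still to be guessed. *)
Lemma inverse_transducerP (s : max_image_size.-bseq B) u w :
  word_morphism h -> run (M := inverse_transducer) s u w <-> u = s ++ h w.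
Proof.
move=> Hh; split.
- elim=> {s u w} [s /nilP -> //|s s' u v w|s s' b u v w] /=.
  + by case: Hh.
  + case: nilP => // -> /mapP[a _ [-> ->]] _ -> /=.
    by rewrite [in RHS](word_morphism_cons a w Hh).
  + case: eqP => // Hs; rewrite inE => /eqP[-> ->] _ -> /=.
    by case: (bseqval s) Hs => //= ? ? [->].
(* Reading the stored word letter by letter reduces to the empty state, the only one in which a
   letter can be guessed or the run can stop. *)
- have Hread w' : (forall s : max_image_size.-bseq B, nilp s ->
        run (M := inverse_transducer) s (s ++ h w') w') ->
      forall s, run (M := inverse_transducer) s (s ++ h w') w'.
    move=> H0 [t Ht]; elim: t Ht => [|b t IH] Ht; first exact: H0.
    apply: (@run_read _ _ inverse_transducer (Bseq Ht) (Bseq (ltnW Ht))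
      b _ [::]) (IH _).
    by rewrite /= eqxx inE; apply/eqP; congr pair; apply: val_inj.
  move=> ->; elim: w s => [|a w IH] s; apply: Hread => {}s Hs.
    by case: Hh => -> _; rewrite (nilP Hs); apply: run_final.
  rewrite (nilP Hs) (word_morphism_cons a w Hh).
  apply: (@run_silent _ _ inverse_transducer _ (Bseq (size_image a)) _ [:: a])
    (IH _).
  by rewrite /= Hs; apply: map_f; rewrite mem_enum.
Qed.

End InverseMorphism.

Theorem theorem16 : full_trio IND_FIN.
Proof.
split.
- move=> A B h L Hh /(IND_FIN_transduction (morphism_transducer h)).
  congr IND_FIN; apply/seteqP; split=> w /=.
    by case=> u Lu /(morphism_transducerP _ _ _ Hh) ->; exists u.
  by case=> u Lu <-; exists u => //; apply/morphism_transducerP.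
- move=> A B h L Hh /(IND_FIN_transduction (inverse_transducer h)).
  congr IND_FIN; apply/seteqP; split=> w /=.
    by case=> u Lu /(inverse_transducerP _ _ _ Hh) /= <-.
  by move=> Lw; exists (h w) => //; apply/inverse_transducerP.
- move=> A L R HL [D ->].
  move: (IND_FIN_transduction (dfa_transducer D) HL).
  congr IND_FIN; apply/seteqP; split=> w /=.
    by case=> u Lu /dfa_transducerP[->].
  by case=> Lw Hw; exists w => //; apply/dfa_transducerP.
Qed.
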